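(* Let $R$ be a $\phi$-ring. Then the following conditions are equivalent: (1) $R$ is a $\phi$-Prüfer ring. (2) $((I+J):K) = (I:K) + (J:K)$ for arbitrary nonnil ideals $I$ and $J$ of $R$ and any finitely generated ideal $K$ of $R$. (3) $(K:(I\cap J)) = (K:I) + (K:J)$ for any finitely generated nonnil ideals $I$ and $J$ of $R$ and an arbitrary ideal $K$ of $R$.
   Context: All rings are commutative with nonzero identity. For a ring $R$, $\mathrm{Nil}(R)$ denotes the ideal of nilpotent elements, $Z(R)$ the set of zerodivisors and $T(R)$ the total quotient ring. For ideals $I, J$ of $R$, the residual is $(I:J) = \{x \in R : xJ \subseteq I\}$. A prime ideal $P$ of $R$ is called divided if it is comparable (under inclusion) to every ideal of $R$. $R$ is a $\phi$-ring if $\mathrm{Nil}(R)$ is a divided prime ideal of $R$. An ideal $I$ of $R$ is nonnil if $I \not\subseteq \mathrm{Nil}(R)$. For a $\phi$-ring $R$, let $\phi: T(R) \to R_{\mathrm{Nil}(R)}$ be the ring homomorphism $\phi(a/b) = a/b$ for $a\in R$, $b \in R\setminus Z(R)$; restricted to $R$ it is the ring homomorphism $x \mapsto x/1$, with image the ring $\phi(R)$. A nonnil ideal $I$ of a $\phi$-ring $R$ is $\phi$-invertible if $\phi(I)$ is an invertible ideal of $\phi(R)$, i.e. $\phi(I)\,\phi(I)^{-1} = \phi(R)$ where $\phi(I)^{-1} = \{x \in T(\phi(R)) : x\phi(I) \subseteq \phi(R)\}$. A $\phi$-ring $R$ is $\phi$-Prüfer if every finitely generated nonnil ideal of $R$ is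 $\phi$-invertible. *)

(* Defs.v *)
From HB Require Import structures.
From mathcomp Require Import all_boot all_algebra.
From mathcomp Require Import boolp classical_sets.
From mathcomp Require Import ring.

Set Implicit Arguments.
Unset Strict Implicit.
Unset Printing Implicit Defensive.

Import GRing.Theory.
Local Open Scope ring_scope.
Local Open Scope classical_set_scope.
Local Open Scope quotient_scope.

Section Ideals.
Variable R : comPzRingType.
Implicit Types I J P A B : set R.

(* Not ring_quotient's [idealr], which only covers proper ideals. *)
Definition is_ideal I : Prop :=
  [/\ I 0, forall x y, I x -> I y -> I (x + y) & forall a x, I x -> I (a * x)].

Definition is_prime_ideal P : Prop :=
  [/\ is_ideal P, ~ P 1 & forall x y, P (x * y) -> P x \/ P y].

Definition is_divided P : Prop :=
  forall I, is_ideal I -> P `<=` I \/ I `<=` P.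

Definition Nil : set R := [set x | exists n, x ^+ n = 0].

Definition is_nonnil_ideal I : Prop := is_ideal I /\ ~ (I `<=` Nil).

Definition ideal_gen n (g : 'I_n -> R) : set R :=
  [set x | exists c : 'I_n -> R, x = \sum_(i < n) c i * g i].

Definition is_fg_ideal I : Prop :=
  exists n (g : 'I_n -> R), I = ideal_gen g.

Definition ideal_add I J : set R :=
  [set z | exists x y, [/\ I x, J y & z = x + y]].

Definition residual I J : set R := [set x | forall y, J y -> I (x * y)].

(* Finite sums of products; also used for products of submodules of a total
   quotient ring. *)
Definition set_mul A B : set R :=
  [set z | exists n (a b : 'I_n -> R),
     [/\ forall i, A (a i), forall i, B (b i) & z = \sum_(i < n) a i * b i]].

Definition zero_divisor : set R := [set x | exists2 y, y != 0 & x * y = 0].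

End Ideals.

Arguments Nil R : clear implicits.
Arguments zero_divisor R : clear implicits.

Record mulset (R : comPzRingType) := MulSet {
  mulset_set : set R;
  mulset1 : mulset_set 1;
  mulsetM : forall x y, mulset_set x -> mulset_set y -> mulset_set (x * y) }.

(* The ring of fractions of R with denominators in S (zero divisors allowed
   in S), as pairs modulo (a, s) ~ (b, t) <-> exists u in S,
   u (a t - b s) = 0. *)
Section Localization.
Variables (R : comPzRingType) (S : mulset R).

Definition denom := {s : R | s \in mulset_set S}.

Lemma denomP (s : denom) : mulset_set S (val s).
Proof. by have := valP s; rewrite in_setE. Qed.

Definition mk_denom s (Ss : mulset_set S s) : denom := exist _ s (mem_set Ss).
Definition denom1 : denom := mk_denom (mulset1 S).
Definition denomM (s t : denom) : denom :=
  mk_denom (mulsetM (denomP s) (denomP t)).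

Definition loc_rel (p q : R * denom) : bool :=
  `[< exists2 u, mulset_set S u & u * (p.1 * val q.2 - q.1 * val p.2) = 0 >].

Lemma loc_rel_refl : reflexive loc_rel.
Proof.
by move=> p; apply/asboolP; exists 1; [exact: mulset1 | rewrite subrr mulr0].
Qed.

Lemma loc_rel_sym : symmetric loc_rel.
Proof.
have H p q : loc_rel p q -> loc_rel q p.
  move=> /asboolP[u Su e]; apply/asboolP; exists u => //.
  by rewrite -opprB mulrN e oppr0.
by move=> p q; apply/idP/idP; exact: H.
Qed.

Lemma loc_rel_trans : transitive loc_rel.
Proof.
move=> q p r /asboolP[u Su e1] /asboolP[v Sv e2]; apply/asboolP.
exists (u * v * val q.2).
  by apply: mulsetM; [exact: mulsetM | exact: denomP].
have -> : u * v * val q.2 * (p.1 * val r.2 - r.1 * val p.2) =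
  v * val r.2 * (u * (p.1 * val q.2 - q.1 * val p.2)) +
  u * val p.2 * (v * (q.1 * val r.2 - r.1 * val q.2)) by ring.
by rewrite e1 e2 !mulr0 addr0.
Qed.

Canonical loc_equiv := EquivRel loc_rel loc_rel_refl loc_rel_sym loc_rel_trans.

Definition loc := {eq_quot loc_rel}.
HB.instance Definition _ : EqQuotient _ loc_rel loc := EqQuotient.on loc.
HB.instance Definition _ := Choice.on loc.

Definition frac (a : R) (s : denom) : loc := \pi_loc (a, s).

Lemma fracE a s b t : frac a s = frac b t <->
  exists2 u, mulset_set S u & u * (a * val t - b * val s) = 0.
Proof.
split=> [/eqmodP/asboolP //|h]; apply/eqmodP; exact/asboolP.
Qed.

Lemma fracW (P : loc -> Prop) : (forall a s, P (frac a s)) -> forall x, P x.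
Proof. by move=> h; elim/quotW => -[a s]; exact: h. Qed.

Definition loc_add (x y : loc) : loc :=
  frac ((repr x).1 * val (repr y).2 + (repr y).1 * val (repr x).2)
       (denomM (repr x).2 (repr y).2).
Definition loc_mul (x y : loc) : loc :=
  frac ((repr x).1 * (repr y).1) (denomM (repr x).2 (repr y).2).
Definition loc_opp (x : loc) : loc := frac (- (repr x).1) (repr x).2.

Lemma frac_repr a s : exists2 u, mulset_set S u &
  u * (a * val (repr (frac a s)).2 - (repr (frac a s)).1 * val s) = 0.
Proof. by apply/fracE; rewrite /frac -surjective_pairing reprK. Qed.

Lemma loc_addE a s b t :
  loc_add (frac a s) (frac b t) = frac (a * val t + b * val s) (denomM s t).
Proof.
rewrite /loc_add; have [u Su eu] := frac_repr a s; have [v Sv ev] := frac_repr b t.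
move: (repr (frac a s)) (repr (frac b t)) eu ev => [a' s'] [b' t'] /= eu ev.
apply/fracE; exists (u * v); first exact: mulsetM.
transitivity (- (v * val t * val t' * (u * (a * val s' - a' * val s)) +
    u * val s * val s' * (v * (b * val t' - b' * val t)))); first by rewrite /=; ring.
by rewrite eu ev !mulr0 addr0 oppr0.
Qed.

Lemma loc_mulE a s b t :
  loc_mul (frac a s) (frac b t) = frac (a * b) (denomM s t).
Proof.
rewrite /loc_mul; have [u Su eu] := frac_repr a s; have [v Sv ev] := frac_repr b t.
move: (repr (frac a s)) (repr (frac b t)) eu ev => [a' s'] [b' t'] /= eu ev.
apply/fracE; exists (u * v); first exact: mulsetM.
transitivity (- (v * b * val t' * (u * (a * val s' - a' * val s)) +
    u * a' * val s * (v * (b * val t' - b' * val t)))); first by rewrite /=; ring.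
by rewrite eu ev !mulr0 addr0 oppr0.
Qed.

Lemma loc_oppE a s : loc_opp (frac a s) = frac (- a) s.
Proof.
rewrite /loc_opp; have [u Su eu] := frac_repr a s.
apply/fracE; exists u => //; move: eu; set x := repr _ => eu.
by rewrite -[RHS]eu; ring.
Qed.

Lemma frac_eq a s b t : a * val t = b * val s -> frac a s = frac b t.
Proof.
by move=> e; apply/fracE; exists 1; [exact: mulset1 | rewrite e subrr mulr0].
Qed.

Lemma loc_addA : associative loc_add.
Proof.
elim/fracW=> a s; elim/fracW=> b t; elim/fracW=> c r.
by rewrite !loc_addE; apply: frac_eq => /=; ring.
Qed.
Lemma loc_addC : commutative loc_add.
Proof.
by elim/fracW=> a s; elim/fracW=> b t; rewrite !loc_addE; apply: frac_eq => /=; ring.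
Qed.
Lemma loc_add0 : left_id (frac 0 denom1) loc_add.
Proof. by elim/fracW=> a s; rewrite loc_addE; apply: frac_eq => /=; ring. Qed.
Lemma loc_addN : left_inverse (frac 0 denom1) loc_opp loc_add.
Proof.
by elim/fracW=> a s; rewrite loc_oppE loc_addE; apply: frac_eq => /=; ring.
Qed.
HB.instance Definition _ :=
  GRing.isZmodule.Build loc loc_addA loc_addC loc_add0 loc_addN.

Lemma loc_mulA : associative loc_mul.
Proof.
elim/fracW=> a s; elim/fracW=> b t; elim/fracW=> c r.
by rewrite !loc_mulE; apply: frac_eq => /=; ring.
Qed.
Lemma loc_mulC : commutative loc_mul.
Proof.
by elim/fracW=> a s; elim/fracW=> b t; rewrite !loc_mulE; apply: frac_eq => /=; ring.
Qed.
Lemma loc_mul1 : left_id (frac 1 denom1) loc_mul.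
Proof. by elim/fracW=> a s; rewrite loc_mulE; apply: frac_eq => /=; ring. Qed.
Lemma loc_mulDl : left_distributive loc_mul (fun x y : loc => x + y).
Proof.
elim/fracW=> a s; elim/fracW=> b t; elim/fracW=> c r.
rewrite -[_ + _]/(loc_add _ _) -[RHS]/(loc_add _ _).
by rewrite !(loc_mulE, loc_addE); apply: frac_eq => /=; ring.
Qed.
HB.instance Definition _ :=
  GRing.Zmodule_isComPzRing.Build loc loc_mulA loc_mulC loc_mul1 loc_mulDl.

Lemma fracD a s b t :
  frac a s + frac b t = frac (a * val t + b * val s) (denomM s t).
Proof. exact: loc_addE. Qed.
Lemma fracM a s b t : frac a s * frac b t = frac (a * b) (denomM s t).
Proof. exact: loc_mulE. Qed.
Lemma fracN a s : - frac a s = frac (- a) s.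
Proof. exact: loc_oppE. Qed.

Definition to_loc (a : R) : loc := frac a denom1.

Lemma to_loc_zmod : zmod_morphism to_loc.
Proof.
by move=> a b; rewrite /to_loc fracN fracD; apply: frac_eq => /=; ring.
Qed.
Lemma to_loc_monoid : monoid_morphism to_loc.
Proof.
by split=> // a b; rewrite /to_loc fracM; apply: frac_eq => /=; ring.
Qed.
HB.instance Definition _ := GRing.isZmodMorphism.Build R loc to_loc to_loc_zmod.
HB.instance Definition _ :=
  GRing.isMonoidMorphism.Build R loc to_loc to_loc_monoid.

End Localization.

(* a/s |-> a/s, from S^-1 R to S'^-1 R, for S contained in S'. *)
Section LocalizationMap.
Variables (R : comPzRingType) (S S' : mulset R).
Hypothesis SS' : mulset_set S `<=` mulset_set S'.

Definition loc_map (x : loc S) : loc S' :=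
  frac (repr x).1 (mk_denom (SS' (denomP (repr x).2))).

Lemma loc_mapE a s : loc_map (frac a s) = frac a (mk_denom (SS' (denomP s))).
Proof.
rewrite /loc_map; have [u Su eu] := frac_repr a s.
by apply/esym/fracE; exists u => //; exact: SS'.
Qed.

Lemma loc_map_zmod : zmod_morphism loc_map.
Proof.
elim/fracW=> a s; elim/fracW=> b t.
by rewrite (loc_mapE a s) (loc_mapE b t) !fracN !fracD loc_mapE; apply: frac_eq.
Qed.
Lemma loc_map_monoid : monoid_morphism loc_map.
Proof.
split; first by rewrite -[1]/(frac 1 (denom1 S)) loc_mapE; apply: frac_eq.
elim/fracW=> a s; elim/fracW=> b t.
by rewrite (loc_mapE a s) (loc_mapE b t) !fracM loc_mapE; apply: frac_eq.
Qed.
HB.instance Definition _ :=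
  GRing.isZmodMorphism.Build (loc S) (loc S') loc_map loc_map_zmod.
HB.instance Definition _ :=
  GRing.isMonoidMorphism.Build (loc S) (loc S') loc_map loc_map_monoid.

End LocalizationMap.

Section ImageRing.
Variables (A B : comPzRingType) (f : {rmorphism A -> B}).

Definition image_pred : pred B := fun y => y \in range f.

Lemma image_predP y : reflect (exists x, y = f x) (y \in image_pred).
Proof.
apply: (iffP idP) => [|[x ->]].
  by rewrite /in_mem /= => /set_mem[x _ <-]; exists x.
by rewrite /in_mem /=; apply: mem_set; exists x.
Qed.

Lemma image_subring : subring_closed image_pred.
Proof.
split.
- by apply/image_predP; exists 1; rewrite rmorph1.
- move=> _ _ /image_predP[x ->] /image_predP[y ->].
  by apply/image_predP; exists (x - y); rewrite rmorphB.
- move=> _ _ /image_predP[x ->] /image_predP[y ->].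
  by apply/image_predP; exists (x * y); rewrite rmorphM.
Qed.

Definition image_ring := {y : B | image_pred y}.
HB.instance Definition _ := [isSub of image_ring for sval].
HB.instance Definition _ := [Choice of image_ring by <:].
HB.instance Definition _ :=
  GRing.SubChoice_isSubComPzRing.Build B image_pred image_ring image_subring.

Definition to_image (x : A) : image_ring :=
  exist _ (f x) (introT (image_predP _) (ex_intro _ x erefl)).

Lemma to_image_zmod : zmod_morphism to_image.
Proof. by move=> x y; apply: val_inj; rewrite /= rmorphB. Qed.
Lemma to_image_monoid : monoid_morphism to_image.
Proof. by split=> [|x y]; apply: val_inj; rewrite /= ?rmorph1 ?rmorphM. Qed.
HB.instance Definition _ :=
  GRing.isZmodMorphism.Build A image_ring to_image to_image_zmod.
HB.instance Definition _ :=
  GRing.isMonoidMorphism.Build A image_ring to_image to_image_monoid.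

End ImageRing.

Section TotalQuotientRing.
Variable A : comPzRingType.

Lemma regular1 : (~` zero_divisor A) 1.
Proof. by move=> [y /eqP y0]; rewrite mul1r. Qed.

Lemma regularM (x y : A) :
  (~` zero_divisor A) x -> (~` zero_divisor A) y -> (~` zero_divisor A) (x * y).
Proof.
move=> hx hy [z z0 e]; have [yz0|yz] := eqVneq (y * z) 0; first by apply: hy; exists z.
by apply: hx; exists (y * z); rewrite // mulrA.
Qed.

Definition regular_mulset := MulSet regular1 regularM.

Definition total_quotient := loc regular_mulset.

Definition to_total : {rmorphism A -> total_quotient} := to_loc regular_mulset.

Definition fractional_inverse (I : set A) : set total_quotient :=
  [set x | forall y, I y -> range to_total (x * to_total y)].

(* I I^-1 = A inside T(A), A and I being identified with their images there. *)
Definition is_invertible (I : set A) : Prop :=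
  set_mul (to_total @` I) (fractional_inverse I) = range to_total.

End TotalQuotientRing.

(* R is nonzero, as R : comNzRingType. *)
Definition is_phi_ring (R : comNzRingType) : Prop :=
  is_prime_ideal (Nil R) /\ is_divided (Nil R).

Section PhiRing.
Variables (R : comNzRingType) (hR : is_phi_ring R).

Lemma nonnil1 : (~` Nil R) 1.
Proof. by case: hR => -[]. Qed.

Lemma nonnilM (x y : R) :
  (~` Nil R) x -> (~` Nil R) y -> (~` Nil R) (x * y).
Proof. by move=> hx hy; case: hR => -[_ _ hP] _ /hP[]. Qed.

Definition nonnil_mulset := MulSet nonnil1 nonnilM.

Definition loc_Nil := loc nonnil_mulset.

Lemma regular_nonnil : mulset_set (regular_mulset R) `<=` mulset_set nonnil_mulset.
Proof.
move=> x hx [n]; elim: n => [/eqP|n IHn e]; first by rewrite expr0 oner_eq0.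
have [/IHn //|xn] := eqVneq (x ^+ n) 0.
by apply: hx; exists (x ^+ n); rewrite // -exprS.
Qed.

Definition phi : {rmorphism total_quotient R -> loc_Nil} :=
  loc_map regular_nonnil.

(* The subring phi(R) of R_Nil(R), with R mapped into T(R) first. *)
Definition phi_ring := image_ring (phi \o to_total R).

Definition to_phi : {rmorphism R -> phi_ring} := to_image (phi \o to_total R).

Lemma to_phiE x : val (to_phi x) = to_loc nonnil_mulset x.
Proof. by rewrite /= loc_mapE; apply: frac_eq. Qed.

Definition is_phi_invertible (I : set R) : Prop := is_invertible (to_phi @` I).

Definition is_phi_Prufer : Prop :=
  forall I : set R, is_fg_ideal I -> is_nonnil_ideal I -> is_phi_invertible I.

End PhiRing.

(* Main.v *)
Require Import Defs.
From mathcomp Require Import all_boot all_algebra.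
From mathcomp Require Import boolp classical_sets.
From mathcomp Require Import ring.

Local Open Scope classical_set_scope.
Import Defs GRing.Theory.
Local Open Scope ring_scope.

Set Implicit Arguments.
Unset Strict Implicit.
Unset Printing Implicit Defensive.

(** Write N for the nilradical of the phi-ring R.  Being divided, N lies in
every nonnil ideal, so relations between nonnil ideals may be read modulo N,
and modulo N the ring is a domain: phi-Pruefer means in effect that R/N is a
Pruefer domain.  The proof avoids quotients and localizations of R by carrying
divisibility modulo N ([dvd_nil]) through the classical argument.

The pivot is [locally_principal]: a family k has elements e_j with sum 1 such
that, modulo N, each e_j sends the ideal of the k_i into the principal ideal
of k_j.  On an open cover of the spectrum the ideal is then principal.  It is
what invertibility of phi(K) says ([invertible_locally_principal],
[locally_principal_invertible]): writing 1 as a sum of phi(k_j) y_j with y_j in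
the inverse, one has phi(e_j) = phi(k_j) y_j.  The case of two-element families
([pairwise_principal]) implies the general one by induction.

From phi-Pruefer to the sum formula: for a principal K, x k = a + b with a in
I and b in J is split by means of a local comparison of k with a
([residual_add_elt]); the partition of unity e_j then glues these splittings
([phi_Prufer_residual_add]).

Taking K = I + J in the sum formula gives 1 in (I:J) + (J:I)
([residual_add_comaximal]), and 1 = a + b with a J in I and b I in J splits
every x in (K : I /\ J) as x b + x a, whatever the ideal K
([residual_cap]).  Taking K = I /\ J in the intersection formula gives back
1 in (I:J) + (J:I) ([residual_cap_comaximal]), which for principal I and J is
the pairwise condition ([comaximal_pairwise_principal]), hence phi-Pruefer. *)

(** * Ideals and residuals *)

Section IdealTheory.
Variable A : comPzRingType.
Implicit Types (I J K : set A) (x y : A).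

Lemma ideal0 I : is_ideal I -> I 0.
Proof. by case. Qed.

Lemma idealD I x y : is_ideal I -> I x -> I y -> I (x + y).
Proof. by case=> _ + _; apply. Qed.

Lemma idealM I a x : is_ideal I -> I x -> I (a * x).
Proof. by case=> _ _; apply. Qed.

Lemma idealB I x y : is_ideal I -> I x -> I y -> I (x - y).
Proof. by move=> hI Ix Iy; apply: idealD; rewrite // -mulN1r; exact: idealM. Qed.

Lemma ideal_sum I n (f : 'I_n -> A) :
  is_ideal I -> (forall i, I (f i)) -> I (\sum_(i < n) f i).
Proof.
move=> hI hf; apply: (big_ind I) => //; first exact: ideal0.
by move=> x y; exact: idealD.
Qed.

Lemma ideal_gen_sub I n (k : 'I_n -> A) :
  is_ideal I -> (forall i, I (k i)) -> ideal_gen k `<=` I.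
Proof.
by move=> hI hk _ [c ->]; apply: ideal_sum => // i; exact: idealM.
Qed.

Lemma ideal_gen_ideal n (k : 'I_n -> A) : is_ideal (ideal_gen k).
Proof.
split.
- by exists (fun=> 0); rewrite big1 // => i _; rewrite mul0r.
- move=> _ _ [c ->] [d ->]; exists (fun i => c i + d i).
  by rewrite -big_split; apply: eq_bigr => i _; rewrite mulrDl.
- move=> a _ [c ->]; exists (fun i => a * c i).
  by rewrite mulr_sumr; apply: eq_bigr => i _; rewrite mulrA.
Qed.

Lemma mem_ideal_gen n (k : 'I_n -> A) j : ideal_gen k (k j).
Proof.
exists (fun i => (i == j)%:R); rewrite (bigD1 j) //= eqxx mul1r big1 ?addr0 //.
by move=> i /negbTE ->; rewrite mul0r.
Qed.

Definition principal_ideal x : set A := ideal_gen (fun _ : 'I_1 => x).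

Lemma principal_idealP x y : principal_ideal x y <-> exists r, y = r * x.
Proof.
split=> [[c ->]|[r ->]]; first by exists (c ord0); rewrite big_ord1.
by exists (fun=> r); rewrite big_ord1.
Qed.

Lemma mem_principal_ideal x : principal_ideal x x.
Proof. by apply/principal_idealP; exists 1; rewrite mul1r. Qed.

Lemma ideal_add_ideal I J : is_ideal I -> is_ideal J -> is_ideal (ideal_add I J).
Proof.
move=> hI hJ; split.
- by exists 0, 0; rewrite addr0; split; [exact: ideal0 | exact: ideal0 |].
- move=> _ _ [x [y [Ix Jy ->]]] [x' [y' [Ix' Jy' ->]]].
  by exists (x + x'), (y + y'); rewrite addrACA; split; [exact: idealD..|].
- move=> a _ [x [y [Ix Jy ->]]].
  by exists (a * x), (a * y); rewrite mulrDr; split; [exact: idealM..|].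
Qed.

Lemma ideal_add_fg I J :
  is_fg_ideal I -> is_fg_ideal J -> is_fg_ideal (ideal_add I J).
Proof.
move=> [m [f ->]] [n [g ->]].
exists (m + n)%N, (fun i => match split i with inl i => f i | inr j => g j end).
apply/seteqP; split=> [_ [_ [_ [[c ->] [d ->] ->]]]|_ [c ->]].
  exists (fun i => match split i with inl i => c i | inr j => d j end).
  rewrite big_split_ord; congr (_ + _); apply: eq_bigr => i _.
    by rewrite (unsplitK (inl i)).
  by rewrite (unsplitK (inr i)).
rewrite big_split_ord; exists (\sum_i c (lshift n i) * f i).
exists (\sum_j c (rshift m j) * g j); split; [by eexists.. |].
congr (_ + _); apply: eq_bigr => i _.
  by rewrite (unsplitK (inl i)).
by rewrite (unsplitK (inr i)).
Qed.

Lemma ideal_cap I J : is_ideal I -> is_ideal J -> is_ideal (I `&` J).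
Proof.
move=> hI hJ; split.
- by split; exact: ideal0.
- by move=> x y [Ix Jx] [Iy Jy]; split; exact: idealD.
- by move=> a x [Ix Jx]; split; exact: idealM.
Qed.

Lemma residual_ideal I K : is_ideal I -> is_ideal (residual I K).
Proof.
move=> hI; split.
- by move=> y _; rewrite mul0r; exact: ideal0.
- by move=> x x' hx hx' y Ky; rewrite mulrDl; apply: idealD; [|exact: hx|exact: hx'].
- by move=> a x hx y Ky; rewrite -mulrA; apply: idealM => //; exact: hx.
Qed.

Lemma residual_gen I n (k : 'I_n -> A) x :
  is_ideal I -> (forall i, I (x * k i)) -> residual I (ideal_gen k) x.
Proof.
move=> hI hx _ [c ->]; rewrite mulr_sumr; apply: ideal_sum => // i.
by rewrite mulrCA; exact: idealM.
Qed.

Lemma ideal_addS I J I' J' :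
  I `<=` I' -> J `<=` J' -> ideal_add I J `<=` ideal_add I' J'.
Proof.
by move=> sI sJ _ [x [y [/sI Ix /sJ Jy ->]]]; exists x, y.
Qed.

Lemma residual_addS I J K :
  is_ideal I -> is_ideal J ->
  ideal_add (residual I K) (residual J K) `<=` residual (ideal_add I J) K.
Proof.
move=> hI hJ _ [x [y [hx hy ->]]] z Kz.
by exists (x * z), (y * z); rewrite mulrDl; split; [exact: hx | exact: hy |].
Qed.

Lemma residual_capS I J K :
  is_ideal K ->
  ideal_add (residual K I) (residual K J) `<=` residual K (I `&` J).
Proof.
move=> hK _ [x [y [hx hy ->]]] z [Iz Jz].
by rewrite mulrDl; apply: idealD => //; [exact: hx | exact: hy].
Qed.

Lemma residual_self I : residual I I 1.
Proof. by move=> x; rewrite mul1r. Qed.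

(** If 1 = a + b with a J in I and b I in J, then both a J and b I lie in the
intersection, so any x sending the intersection into K splits as x b + x a. *)
Lemma residual_cap I J K :
  is_ideal I -> is_ideal J -> is_ideal K ->
  ideal_add (residual I J) (residual J I) 1 ->
  residual K (I `&` J) = ideal_add (residual K I) (residual K J).
Proof.
move=> hI hJ hK [a [b [aJI bIJ ab]]]; apply/seteqP; split; last exact: residual_capS.
move=> x hx; exists (x * b), (x * a); split.
- by move=> y Iy; rewrite -mulrA; apply: hx; split; [exact: idealM | exact: bIJ].
- by move=> y Jy; rewrite -mulrA; apply: hx; split; [exact: aJI | exact: idealM].
- by rewrite -mulrDr addrC -ab mulr1.
Qed.

End IdealTheory.

Lemma image_ideal_gen (A B : comPzRingType) (f : {rmorphism A -> B}) n
    (k : 'I_n -> A) :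
  (forall y, exists x, y = f x) -> f @` ideal_gen k = ideal_gen (f \o k).
Proof.
move=> fsurj; apply/seteqP; split=> [_ [_ [c ->] <-]|_ [c ->]].
  by exists (f \o c); rewrite rmorph_sum; apply: eq_bigr => i _; rewrite rmorphM.
have [d hd] := choice (fun i => fsurj (c i)).
exists (\sum_(i < n) d i * k i); first by exists d.
by rewrite rmorph_sum; apply: eq_bigr => i _; rewrite rmorphM hd.
Qed.

(** * Invertible ideals and partitions of unity *)

Section Invertibility.
Variable A : comPzRingType.

Lemma to_total_inj : injective (@to_total A).
Proof.
move=> x y /fracE[u hu e]; apply/eqP; rewrite -subr_eq0.
apply/negPn/negP => xy; apply: hu; exists (x - y) => //.
by rewrite -[RHS]e /= !mulr1.
Qed.

(** Expanding 1 in I I^-1 along the generators gives 1 as a sum of k_j z_j with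
z_j in the inverse; e_j = k_j z_j then works, because
e_j k_i = (z_j k_i) k_j. *)
Lemma invertible_locally_principal n (k : 'I_n -> A) :
  is_invertible (ideal_gen k) ->
  exists e : 'I_n -> A, \sum_(j < n) e j = 1 /\
    forall i j, exists r, e j * k i = r * k j.
Proof.
move=> inv; have : range (@to_total A) 1 by exists 1; rewrite // rmorph1.
rewrite -inv => -[m [a [y [ha hy e1]]]].
have /choice[c hc] : forall l, exists c : 'I_n -> A,
    a l = to_total A (\sum_(j < n) c j * k j).
  by move=> l; have [_ [c ->] <-] := ha l; exists c.
pose z j := \sum_(l < m) to_total A (c l j) * y l.
have hz i j : exists r, to_total A r = z j * to_total A (k i).
  have /choice[r hr] : forall l, exists r, to_total A r = y l * to_total A (k i).
    by move=> l; have [r _ hr] := hy l _ (mem_ideal_gen k i); exists r.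
  exists (\sum_(l < m) c l j * r l); rewrite rmorph_sum mulr_suml.
  by apply: eq_bigr => l _; rewrite rmorphM hr mulrA.
have /choice[e he] : forall j, exists e, to_total A e = z j * to_total A (k j).
  by move=> j; exact: hz.
exists e; split=> [|i j].
  apply: to_total_inj; rewrite rmorph1 rmorph_sum e1.
  under eq_bigr => j _ do rewrite he mulr_suml.
  rewrite exchange_big; apply: eq_bigr => l _.
  rewrite hc rmorph_sum mulr_suml; apply: eq_bigr => j _.
  by rewrite rmorphM mulrAC.
have [r hr] := hz i j; exists r; apply: to_total_inj.
by rewrite !rmorphM he hr mulrAC.
Qed.

(** The fractions e_j / k_j lie in the inverse and give 1 in I I^-1.  The
alternative e_j = 0 allows for zero-divisors among the generators. *)
Lemma locally_principal_invertible n (k e : 'I_n -> A) :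
  \sum_(j < n) e j = 1 ->
  (forall i j, exists r, e j * k i = r * k j) ->
  (forall j, e j = 0 \/ (~` zero_divisor A) (k j)) ->
  is_invertible (ideal_gen k).
Proof.
move=> e1 he hk; apply/seteqP; split=> [_ [m [a [y [ha hy ->]]]]|_ [x _ <-]].
  have /choice[r hr] : forall l, exists r, to_total A r = a l * y l.
    move=> l; have [x gx <-] := ha l; have [r _ hr] := hy l x gx.
    by exists r; rewrite hr mulrC.
  by exists (\sum_l r l) => //; rewrite rmorph_sum; apply: eq_bigr => l _.
have /choice[y hy] : forall j, exists y : total_quotient A,
    [/\ to_total A (k j) * y = to_total A (e j)
      & fractional_inverse (ideal_gen k) y].
  move=> j; case: (hk j) => [-> | reg].
    by exists 0; rewrite mulr0 rmorph0; split=> // z _; exists 0; rewrite // mul0r rmorph0.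
  have den : mulset_set (regular_mulset A) (k j) by [].
  exists (frac (e j) (mk_denom den)); split.
    by rewrite [LHS]fracM; apply: frac_eq => /=; ring.
  move=> _ [c ->]; have /choice[r hr] := he^~ j.
  exists (\sum_i c i * r i) => //.
  rewrite [RHS]fracM; apply: frac_eq => /=.
  rewrite !mulr1 mulr_suml mulr_sumr; apply: eq_bigr => i _.
  by rewrite mulrCA hr mulrA.
exists n, (fun j => to_total A (k j)), (fun j => to_total A x * y j); split.
- by move=> j; exists (k j) => //; exact: mem_ideal_gen.
- move=> j z gz; have [r _ hr] := (hy j).2 z gz.
  by exists (x * r) => //; rewrite rmorphM hr mulrA.
- rewrite -[x in LHS]mulr1 -e1 mulr_sumr rmorph_sum; apply: eq_bigr => j _.
  by rewrite rmorphM mulrCA (hy j).1.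
Qed.

End Invertibility.

(** * Divisibility modulo the nilradical *)

Section PhiRings.
Variables (R : comNzRingType) (hR : is_phi_ring R).
Implicit Types (I J K : set R) (x y z : R).

Let N_ideal : is_ideal (Nil R).
Proof. by case: hR => -[]. Qed.

Lemma Nil_prime x y : Nil R (x * y) -> Nil R x \/ Nil R y.
Proof. by case: hR => -[_ _ h] _; exact: h. Qed.

Lemma Nil_sub_nonnil I : is_nonnil_ideal I -> Nil R `<=` I.
Proof. by case: hR => _ div [hI nI]; case: (div I hI). Qed.

Lemma nonnil_principal x : ~ Nil R x -> is_nonnil_ideal (principal_ideal x).
Proof.
move=> nx; split; first exact: ideal_gen_ideal.
by move/(_ _ (mem_principal_ideal x)).
Qed.

(** Here x is not nilpotent, so the divided ideal N lies in (x); thus 1 - x,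
and with it 1, is a multiple of x. *)
Lemma unit_of_sub1_Nil x : Nil R (1 - x) -> exists u, u * x = 1.
Proof.
move=> hx; have nx : ~ Nil R x.
  move=> Nx; apply: (nonnil1 hR); rewrite /= -[1](subrK x).
  exact: idealD.
have /principal_idealP[t e] := Nil_sub_nonnil (nonnil_principal nx) hx.
by exists (t + 1); rewrite mulrDl -e mul1r subrK.
Qed.

Definition dvd_nil y x : Prop := exists r, Nil R (x - r * y).

Lemma Nil_dvd_nil y x : Nil R x -> dvd_nil y x.
Proof. by exists 0; rewrite mul0r subr0. Qed.

Lemma dvd_nil_mull y a : dvd_nil y (a * y).
Proof. by exists a; rewrite subrr; exact: ideal0. Qed.

Lemma dvd_nilD y x x' : dvd_nil y x -> dvd_nil y x' -> dvd_nil y (x + x').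
Proof.
move=> [r hr] [r' hr']; exists (r + r').
by rewrite mulrDl opprD addrACA; exact: idealD.
Qed.

Lemma dvd_nil_mul2l a y x : dvd_nil y x -> dvd_nil (a * y) (a * x).
Proof.
move=> [r hr]; exists r; rewrite mulrCA -mulrBr; exact: idealM.
Qed.

Lemma dvd_nil_trans y x z : dvd_nil z y -> dvd_nil y x -> dvd_nil z x.
Proof.
move=> [r hr] [s hs]; exists (s * r).
have -> : x - s * r * z = (x - s * y) + s * (y - r * z) by ring.
by apply: idealD => //; exact: idealM.
Qed.

Lemma dvd_nil_mulr y a x : dvd_nil y x -> dvd_nil y (a * x).
Proof. by move=> h; apply: dvd_nil_trans h _; exact: dvd_nil_mull. Qed.

Lemma dvd_nil_sum n y (f : 'I_n -> R) :
  (forall i, dvd_nil y (f i)) -> dvd_nil y (\sum_(i < n) f i).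
Proof.
move=> h; apply: (big_ind (dvd_nil y)) => //; last exact: dvd_nilD.
by apply: Nil_dvd_nil; exact: ideal0.
Qed.

(** This is how relations modulo N are turned back into exact memberships. *)
Lemma nonnil_ideal_dvd I y x : is_nonnil_ideal I -> I y -> dvd_nil y x -> I x.
Proof.
move=> hI Iy [r /(Nil_sub_nonnil hI) h]; rewrite -[x](subrK (r * y)).
by apply: idealD => //; [case: hI | apply: idealM => //; case: hI].
Qed.

Lemma dvd_nilP y x : ~ Nil R y -> dvd_nil y x -> exists r, x = r * y.
Proof.
move=> /nonnil_principal hy h; apply/principal_idealP.
by apply: nonnil_ideal_dvd h => //; exact: mem_principal_ideal.
Qed.

Definition locally_principal n (k : 'I_n -> R) : Prop :=
  exists e : 'I_n -> R, \sum_(j < n) e j = 1 /\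
    forall i j, dvd_nil (k j) (e j * k i).

Definition pairwise_principal : Prop :=
  forall x y, exists c d, [/\ c + d = 1, dvd_nil x (c * y) & dvd_nil y (d * x)].

(** * Phi-Pruefer rings and partitions of unity *)

Lemma to_phi_surj (y : phi_ring hR) : exists x, y = to_phi hR x.
Proof. by case/image_predP: (valP y) => x e; exists x; exact: val_inj. Qed.

Lemma to_phi_eq_nil x y : to_phi hR x = to_phi hR y -> Nil R (x - y).
Proof.
move=> /(congr1 val); rewrite !to_phiE => /fracE[u /= hu].
rewrite !mulr1 => e; case: (@Nil_prime u (x - y)) => //.
by rewrite e; exact: ideal0.
Qed.

Lemma to_phi_regular x :
  ~ Nil R x -> (~` zero_divisor (phi_ring hR)) (to_phi hR x).
Proof.
move=> nx [y]; have [z ->] := to_phi_surj y => /eqP z0.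
rewrite -rmorphM -(rmorph0 (to_phi hR)) => /(congr1 val).
rewrite !to_phiE => /fracE[u /= hu e]; apply: z0.
apply: val_inj; rewrite -(rmorph0 (to_phi hR)) !to_phiE; apply/fracE.
exists (u * x); first exact: nonnilM.
by rewrite -[RHS]e /=; ring.
Qed.

(** The partition of unity is obtained in phi(R).  Since the kernel of phi lies
in N, its lift to R satisfies the divisibilities modulo N and has sum 1 modulo
N, hence a unit; rescaling makes the sum 1. *)
Lemma phi_Prufer_locally_principal n (k : 'I_n.+1 -> R) :
  is_phi_Prufer hR -> locally_principal k.
Proof.
move=> prf; have [nilk|nnilk] := pselect (ideal_gen k `<=` Nil R).
  (* Among nilpotents every divisibility modulo N holds. *)
  exists (fun j => (j == ord0)%:R); split.
    by rewrite (bigD1 ord0) //= big1 ?addr0 // => i /negbTE ->.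
  move=> i j; apply: Nil_dvd_nil; apply: idealM => //.
  exact/nilk/mem_ideal_gen.
have : is_invertible (ideal_gen (to_phi hR \o k)).
  rewrite -image_ideal_gen; last exact: to_phi_surj.
  apply: prf; first by exists n.+1, k.
  by split=> //; exact: ideal_gen_ideal.
case/invertible_locally_principal => e' [e1 he].
have /choice[e ee] : forall j, exists e, e' j = to_phi hR e.
  by move=> j; exact: to_phi_surj.
have [u hu] : exists u, u * \sum_j e j = 1.
  apply: unit_of_sub1_Nil; apply: to_phi_eq_nil.
  by rewrite rmorph1 -e1 rmorph_sum; apply: eq_bigr => j _.
exists (fun j => u * e j); split; first by rewrite -mulr_sumr.
move=> i j; rewrite -mulrA; apply: dvd_nil_mulr.
have [r' hr] := he i j; have [r er] := to_phi_surj r'.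
by exists r; apply: to_phi_eq_nil; rewrite !rmorphM -ee -er.
Qed.

Lemma phi_Prufer_pairwise_principal :
  is_phi_Prufer hR -> pairwise_principal.
Proof.
move=> prf x y.
pose k (i : 'I_2) := if i == ord0 then x else y.
have [e [e1 he]] := phi_Prufer_locally_principal k prf.
exists (e ord0), (e (lift ord0 ord0)); split.
- by rewrite -e1 big_ord_recl big_ord1.
- exact: (he (lift ord0 ord0) ord0).
- exact: (he ord0 (lift ord0 ord0)).
Qed.

(** Adding a generator k_0 to a family with partition of unity e_j: each e_j is
refined by 1 = c_j + d_j comparing k_0 with k_j.  On the part e_j c_j the
element k_j divides k_0 and remains a generator; the parts e_j d_j, where k_0
divides k_j, are collected into the coefficient of k_0. *)
Lemma pairwise_locally_principal n (k : 'I_n.+1 -> R) :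
  pairwise_principal -> locally_principal k.
Proof.
move=> pp; elim: n k => [|n IHn] k.
  exists (fun=> 1); split; first by rewrite big_ord1.
  by move=> i j; rewrite !ord1; exact: dvd_nil_mull.
have [e [e1 he]] := IHn (fun i => k (lift ord0 i)).
have /choice[cd hcd] : forall j, exists cd : R * R,
    [/\ cd.1 + cd.2 = 1, dvd_nil (k (lift ord0 j)) (cd.1 * k ord0)
      & dvd_nil (k ord0) (cd.2 * k (lift ord0 j))].
  by move=> j; have [c [d h]] := pp (k (lift ord0 j)) (k ord0); exists (c, d).
exists (fun i => if unlift ord0 i is Some j then e j * (cd j).1
                 else \sum_j e j * (cd j).2); split.
  rewrite big_ord_recl unlift_none -e1.
  under [X in _ + X]eq_bigr => j _ do rewrite liftK.
  rewrite -big_split; apply: eq_bigr => j _ /=.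
  by have [h _ _] := hcd j; rewrite -mulrDr addrC h mulr1.
move=> i j; case: (unliftP ord0 j) => [j' ->|->].
  have [_ h _] := hcd j'.
  case: (unliftP ord0 i) => [i' ->|->]; last first.
    by rewrite -mulrA; exact: dvd_nil_mulr.
  by rewrite mulrAC mulrC; exact/dvd_nil_mulr/he.
rewrite mulr_suml; apply: dvd_nil_sum => j'.
have [_ _ h] := hcd j'.
case: (unliftP ord0 i) => [i' ->|->]; last exact: dvd_nil_mull.
apply: dvd_nil_trans h _; rewrite mulrAC [X in dvd_nil _ X]mulrC.
exact: dvd_nil_mul2l.
Qed.

(** For a nonnil ideal the partition of unity can be made exact.  If k_j is
nilpotent and k_i is not, then e_j k_i in N forces e_j in N, so dropping these
e_j changes the sum by a nilpotent only; if k_j is not nilpotent, N lies in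
(k_j) and divisibility modulo N is divisibility. *)
Lemma locally_principal_nonnil n (k : 'I_n -> R) :
  ~ (ideal_gen k `<=` Nil R) -> locally_principal k ->
  exists e : 'I_n -> R, [/\ \sum_(j < n) e j = 1,
    forall i j, exists r, e j * k i = r * k j &
    forall j, Nil R (k j) -> e j = 0].
Proof.
move=> nnil [e [e1 he]].
have [i0 ni0] : exists i, ~ Nil R (k i).
  apply: contrapT => /forallNP h; apply: nnil; apply: ideal_gen_sub => // i.
  exact: contrapT (h i).
have nile j : Nil R (k j) -> Nil R (e j).
  move=> nj; have [r hr] := he i0 j; case: (@Nil_prime (e j) (k i0)) => //.
  by rewrite -[X in Nil R X](subrK (r * k j)); apply: idealD => //; exact: idealM.
pose f j := if `[< Nil R (k j) >] then 0 else e j.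
have [u hu] : exists u, u * \sum_j f j = 1.
  apply: unit_of_sub1_Nil; rewrite -e1 -sumrB; apply: ideal_sum => // j.
  rewrite /f; case: asboolP => [/nile|_]; first by rewrite subr0.
  by rewrite subrr; exact: ideal0.
exists (fun j => u * f j); split; first by rewrite -mulr_sumr.
  move=> i j; rewrite /f; case: asboolP => [_|nj].
    by exists 0; rewrite mulr0 !mul0r.
  have [r hr] := dvd_nilP nj (he i j).
  by exists (u * r); rewrite -!mulrA hr.
by move=> j nj; rewrite /f; case: asboolP => // _; rewrite mulr0.
Qed.

Lemma pairwise_principal_phi_Prufer :
  pairwise_principal -> is_phi_Prufer hR.
Proof.
move=> pp _ [[|n] [k ->]] [_ nnil].
  by case: nnil => _ [c ->]; rewrite big_ord0; exact: ideal0.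
have [e [e1 he hnil]] :=
  locally_principal_nonnil nnil (pairwise_locally_principal k pp).
rewrite /is_phi_invertible image_ideal_gen; last exact: to_phi_surj.
apply: (@locally_principal_invertible _ _ _ (to_phi hR \o e)).
- by rewrite -(rmorph1 (to_phi hR)) -e1 rmorph_sum.
- move=> i j; have [r hr] := he i j.
  by exists (to_phi hR r); rewrite -!rmorphM hr.
- move=> j; have [/hnil ej|nj] := pselect (Nil R (k j)).
    by left; rewrite /= ej rmorph0.
  by right; exact: to_phi_regular.
Qed.

(** * The residual formulas *)

(** Let x k = a + b, and 1 = c + d with c k in (a) + N and d a = s k modulo N.
Where a divides k, k is in I and x itself belongs to (I : k); where k
divides a with quotient s, x = s + (x - s) splits.  Patching with c and d gives
x = (c x + s) + (d x - s). *)
Lemma residual_add_elt I J k x :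
  pairwise_principal -> is_nonnil_ideal I -> is_nonnil_ideal J ->
  ideal_add I J (x * k) ->
  exists u v, [/\ x = u + v, I (u * k) & J (v * k)].
Proof.
move=> pp hI hJ [a [b [Ia Jb xk]]].
have [c [d [cd hc [s hs]]]] := pp a k.
have sk : I (s * k).
  rewrite -[s * k](subKr (d * a)); apply: idealB; first by case: hI.
    by apply: idealM => //; case: hI.
  exact: Nil_sub_nonnil hs.
exists (c * x + s), (d * x - s); split.
- by rewrite addrACA subrr addr0 -mulrDl cd mul1r.
- rewrite mulrDl; apply: idealD => //; first by case: hI.
  rewrite mulrAC mulrC; apply: idealM; first by case: hI.
  exact: nonnil_ideal_dvd hc.
- have -> : (d * x - s) * k = d * b + (d * a - s * k).
    by rewrite mulrBl -mulrA xk; ring.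
  apply: idealD; first by case: hJ.
    by apply: idealM => //; case: hJ.
  exact: Nil_sub_nonnil hs.
Qed.

Lemma phi_Prufer_residual_add I J K :
  is_phi_Prufer hR -> is_nonnil_ideal I -> is_nonnil_ideal J ->
  is_fg_ideal K ->
  residual (ideal_add I J) K = ideal_add (residual I K) (residual J K).
Proof.
move=> prf hI hJ [n [k ->]]; have [idI idJ] := (hI.1, hJ.1).
apply/seteqP; split; last exact: residual_addS.
case: n k => [|n] k x hx.
  exists x, 0; rewrite addr0; split=> //.
    by apply: residual_gen => // -[].
  by apply: ideal0; exact: residual_ideal.
have [e [e1 he]] := phi_Prufer_locally_principal k prf.
(* As e_j K is contained in (k_j) + N, it suffices to control w on k_j. *)
have lift_res L j w : is_nonnil_ideal L -> L (w * k j) ->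
    residual L (ideal_gen k) (e j * w).
  move=> hL Lw; apply: residual_gen => [|i]; first by case: hL.
  apply: nonnil_ideal_dvd Lw _ => //; rewrite mulrAC [X in dvd_nil _ X]mulrC.
  exact: dvd_nil_mul2l.
rewrite -[x]mul1r -e1 mulr_suml; apply: ideal_sum => [|j].
  by apply: ideal_add_ideal; exact: residual_ideal.
have [u [v [-> Iu Jv]]] := residual_add_elt (phi_Prufer_pairwise_principal prf)
  hI hJ (hx _ (mem_ideal_gen k j)).
by exists (e j * u), (e j * v); rewrite mulrDr; split; [exact: lift_res..|].
Qed.

(** The form in which the Pruefer property is extracted from either residual
formula. *)
Definition comaximal_residuals : Prop :=
  forall I J, is_fg_ideal I -> is_nonnil_ideal I ->
    is_fg_ideal J -> is_nonnil_ideal J ->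
    ideal_add (residual I J) (residual J I) 1.

Lemma residual_add_comaximal :
  (forall I J K, is_nonnil_ideal I -> is_nonnil_ideal J -> is_fg_ideal K ->
     residual (ideal_add I J) K
       = ideal_add (residual I K) (residual J K)) ->
  comaximal_residuals.
Proof.
move=> h I J fI nI fJ nJ; have := @residual_self _ (ideal_add I J).
rewrite h //; last exact: ideal_add_fg.
apply: ideal_addS => x hx y yin; apply: hx.
  by exists 0, y; rewrite add0r; split=> //; exact: ideal0 nI.1.
by exists y, 0; rewrite addr0; split=> //; exact: ideal0 nJ.1.
Qed.

Lemma residual_cap_comaximal :
  (forall I J K, is_fg_ideal I -> is_nonnil_ideal I ->
     is_fg_ideal J -> is_nonnil_ideal J -> is_ideal K ->
     residual K (I `&` J) = ideal_add (residual K I) (residual K J)) ->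
  comaximal_residuals.
Proof.
move=> h I J fI nI fJ nJ; have := @residual_self _ (I `&` J).
rewrite h //; last exact: ideal_cap nI.1 nJ.1.
move=> [a [b [ha hb ab]]]; exists b, a; split; last by rewrite addrC.
  by move=> y /hb[].
by move=> y /ha[].
Qed.

Lemma comaximal_pairwise_principal : comaximal_residuals ->
  pairwise_principal.
Proof.
move=> h x y.
have [nx|nx] := pselect (Nil R x).
  exists 0, 1; rewrite add0r mul0r mul1r; split=> //; apply: Nil_dvd_nil => //.
  exact: ideal0.
have [ny|ny] := pselect (Nil R y).
  exists 1, 0; rewrite addr0 mul0r mul1r; split=> //; apply: Nil_dvd_nil => //.
  exact: ideal0.
have fgp z : is_fg_ideal (principal_ideal z) by exists 1%N, (fun=> z).
have [c [d [hc hd cd]]] :=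
  h _ _ (fgp x) (nonnil_principal nx) (fgp y) (nonnil_principal ny).
have /principal_idealP[r er] := hc _ (mem_principal_ideal _).
have /principal_idealP[s es] := hd _ (mem_principal_ideal _).
by exists c, d; rewrite er es; split=> //; exact: dvd_nil_mull.
Qed.

End PhiRings.

Theorem theorem2p6 (R : comNzRingType) (hR : is_phi_ring R) :
  (is_phi_Prufer hR <->
   (forall I J K : set R,
      is_nonnil_ideal I -> is_nonnil_ideal J -> is_fg_ideal K ->
      residual (ideal_add I J) K
        = ideal_add (residual I K) (residual J K)))
  /\
  (is_phi_Prufer hR <->
   (forall I J K : set R,
      is_fg_ideal I -> is_nonnil_ideal I ->
      is_fg_ideal J -> is_nonnil_ideal J ->
      is_ideal K ->
      residual K (I `&` J)
        = ideal_add (residual K I) (residual K J))).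
Proof.
split; split.
- by move=> prf I J K; exact: phi_Prufer_residual_add.
- move=> /residual_add_comaximal h.
  exact/(pairwise_principal_phi_Prufer hR)/(comaximal_pairwise_principal hR).
- move=> prf I J K fI nI fJ nJ hK.
  apply: residual_cap => //; [exact: nI.1 | exact: nJ.1 |].
  apply: residual_add_comaximal => // I' J' K' nI' nJ' fK'.
  exact: phi_Prufer_residual_add.
- move=> /residual_cap_comaximal h.
  exact/(pairwise_principal_phi_Prufer hR)/(comaximal_pairwise_principal hR).
Qed.
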